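(* Let $T$ be a complete first-order theory with infinite models. If $T$ is stable, then $\mathrm{DR}(T)\geq 2$.
   Context: Conventions. $T$ is a complete first-order theory in a language $L$ with infinite models, and $\mathcal{U}\models T$, with universe $U$, is a monster model: universal and strongly $\hat\kappa$-homogeneous for a sufficiently large cardinal $\hat\kappa$. ''Small'' means of cardinality $<\hat\kappa$. Variables and parameters may be tuples (finite or infinite, small); all sequences of parameters are small. EM-types. A sequence $\mathcal{I}=(b_i:i\in I)$ of tuples of the same size, indexed by an infinite linear order, satisfies $\mathcal I\models^{\mathrm{EM}}\phi(x_0,\dots,x_{n-1})$ if $\mathcal{U}\models\phi(b_{i_0},\dots,b_{i_{n-1}})$ for all $i_0<\cdots<i_{n-1}$ in $I$. The EM-type of $\mathcal I$ (over $\varnothing$) is the set of all $L$-formulas $\phi$ in variables $(x_k:k<\omega)$ with $\mathcal I\models^{\mathrm{EM}}\phi$; $\mathcal I$ is indiscernible iff this EM-type is complete. A complete EM-type is the EM-type of some infinite indiscernible sequence. Dedekind partitions. A partition $I=I_0+\cdots+I_n$ of a linear order into nonempty convex sets $I_0<\cdots<I_n$ is Dedekind if for each $i<n$ the set $I_0\cup\cdots\cup I_i$ has no maximum and $I_{i+1}\cup\cdots\cup I_n$ has no minimum; the $i$-th cut is $\mathfrak c_i=(I_0\cup\cdots\cup I_i,\ I_{i+1}\cup\cdots\cup I_n)$. For an indiscernible sequence $\mathcal I$ indexed by $I$, write $\mathcal I=\mathcal I_0+\cdots+\mathcal I_n$ for the corresponding partition. Given $A=(a_0,\dots,a_{n-1})$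 of tuples of the same size as those in $\mathcal I$, a subsequence $A'\subseteq A$ inserts into $\mathcal I_0+\cdots+\mathcal I_n$ if the sequence obtained by inserting each $a_i\in A'$ at the cut $\mathfrak c_i$ is indiscernible. Distality rank. For $n>m>0$, the Dedekind partition $\mathcal I_0+\cdots+\mathcal I_n$ of an indiscernible sequence is $m$-distal if every sequence $A=(a_0,\dots,a_{n-1})$ which does not insert contains an $m$-element subsequence which does not insert. A complete EM-type $\Gamma$ is $m$-distal if every Dedekind partition $\mathcal I_0+\cdots+\mathcal I_{m+1}$ of an indiscernible sequence with EM-type $\Gamma$ is $m$-distal. $T$ is $m$-distal if every complete EM-type, in every tuple size, is $m$-distal. The distality rank $\mathrm{DR}(T)$ is the least $m\ge1$ such that $T$ is $m$-distal, and $\mathrm{DR}(T)=\omega$ if there is no such $m$. *)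

(* Defs.v *)
From HB Require Import structures.
From mathcomp Require Import all_boot all_order.
From mathcomp Require Import boolp classical_sets functions cardinality.

Set Implicit Arguments.
Unset Strict Implicit.
Unset Printing Implicit Defensive.

Import Order.TTheory.
Local Open Scope classical_set_scope.
Local Open Scope card_scope.

(** * First-order logic *)

Record language := Language {
  fsym : Type;
  fsym_arity : fsym -> nat;
  rsym : Type;
  rsym_arity : rsym -> nat
}.

(* The parameter [V] is the type of free variables. A quantifier binds the
   variable [None] of a formula over [option V], so that [formula L V] is the
   type of all L-formulas with free variables among those of [V]. *)
Inductive term (L : language) (V : Type) : Type :=
| tvar of V
| tapp (f : fsym L) of ('I_(fsym_arity f) -> term L V).

Inductive formula (L : language) (V : Type) : Type :=
| fbot
| feq of term L V & term L V
| frel (r : rsym L) of ('I_(rsym_arity r) -> term L V)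
| fimp of formula L V & formula L V
| fall of formula L (option V).

Arguments tvar {L V}.
Arguments tapp {L V}.
Arguments fbot {L V}.
Arguments feq {L V}.
Arguments frel {L V}.
Arguments fimp {L V}.
Arguments fall {L V}.

Definition fneg L V (phi : formula L V) : formula L V := fimp phi fbot.

Record structure (L : language) := Structure {
  dom :> Type;
  dom_inhabited : inhabited dom;
  finterp : forall f : fsym L, ('I_(fsym_arity f) -> dom) -> dom;
  rinterp : forall r : rsym L, ('I_(rsym_arity r) -> dom) -> Prop
}.

Section Semantics.
Variables (L : language) (M : structure L).

Fixpoint eval V (e : V -> M) (t : term L V) : M :=
  match t with
  | tvar v => e v
  | tapp f args => finterp (fun i => eval e (args i))
  end.

Definition extend V (e : V -> M) (x : M) (v : option V) : M := oapp e x v.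

Fixpoint sat V (e : V -> M) (phi : formula L V) : Prop :=
  match phi with
  | fbot => False
  | feq t u => eval e t = eval e u
  | frel r args => rinterp (fun i => eval e (args i))
  | fimp p q => sat e p -> sat e q
  | fall p => forall x : M, sat (extend e x) p
  end.

End Semantics.

(** * Theories *)

Definition sentence (L : language) := formula L void.

Definition theory (L : language) := set (sentence L).

Definition holds L (M : structure L) (s : sentence L) : Prop :=
  sat (of_void M) s.

Definition models L (M : structure L) (T : theory L) : Prop :=
  forall s, T s -> holds M s.

Definition entails L (T : theory L) (s : sentence L) : Prop :=
  forall M : structure L, models M T -> holds M s.

Definition complete_theory L (T : theory L) : Prop :=
  (exists M : structure L, models M T) /\
  (forall s, entails T s \/ entails T (fneg s)).

Definition has_infinite_models L (T : theory L) : Prop :=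
  exists M : structure L, models M T /\ infinite_set [set: M].

(* [phi(x; y)], where [x] is a [p]-tuple and [y] is a [q]-tuple of variables. *)
Definition has_order_property L (M : structure L) p q
    (phi : formula L ('I_p + 'I_q)) : Prop :=
  exists (a : nat -> 'I_p -> M) (b : nat -> 'I_q -> M),
    forall i j : nat,
      sat (fun v => match v with inl k => a i k | inr k => b j k end) phi
      <-> (i < j)%N.

Definition stable L (T : theory L) : Prop :=
  forall (M : structure L) p q (phi : formula L ('I_p + 'I_q)),
    models M T -> ~ has_order_property M phi.

(** * Monster models *)

Definition elementary_embedding L (M N : structure L) (h : M -> N) : Prop :=
  forall n (phi : formula L 'I_n) (e : 'I_n -> M),
    sat e phi <-> sat (h \o e) phi.

(* [h] is only relevant on [A]. *)
Definition partial_elementary L (M : structure L) (A : set M) (h : M -> M) :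
    Prop :=
  forall n (phi : formula L 'I_n) (e : 'I_n -> M),
    (forall i, A (e i)) -> (sat e phi <-> sat (h \o e) phi).

Definition automorphism L (M : structure L) (h : M -> M) : Prop :=
  [/\ bijective h,
      forall (f : fsym L) (args : 'I_(fsym_arity f) -> M),
        h (finterp args) = finterp (h \o args)
    & forall (r : rsym L) (args : 'I_(rsym_arity r) -> M),
        rinterp args <-> rinterp (h \o args)].

(* [A] has cardinality strictly smaller than the cardinal of the type [K]. *)
Definition smaller_than (K : Type) U (A : set U) : Prop :=
  ~ ([set: K] #<= A).

(* The cardinal kappa-hat is that of the type [kappa]. Sufficiently large means
   larger than |L| + aleph_0, the number of L-formulas in countably many
   variables. *)
Record monster L (T : theory L) := Monster {
  kappa : Type;
  universe :> structure L;
  kappa_large : smaller_than kappa [set: formula L nat];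
  monster_models : models universe T;
  monster_universal : forall M : structure L,
    models M T -> smaller_than kappa [set: M] ->
    exists h : M -> universe, elementary_embedding h;
  monster_homogeneous : forall (A : set universe) (h : universe -> universe),
    smaller_than kappa A -> partial_elementary A h ->
    exists s : universe -> universe,
      automorphism s /\ (forall x, A x -> s x = h x)
}.

Definition small L (T : theory L) (U : monster T) (X : Type) : Prop :=
  smaller_than (kappa U) [set: X].

(** * Dedekind partitions and insertion of points at their cuts *)

(* A partition of [I] into nonempty convex sets I_0 < ... < I_n is given by the
   nondecreasing surjection [part] sending each point to the index of its block.
   Thus the i-th cut is ([set x | part x <= i], [set x | i < part x]). *)
Record dedekind d (I : orderType d) (n : nat) := Dedekind {
  part :> I -> 'I_n.+1;
  part_nondecreasing : forall x y : I, (x <= y)%O -> (part x <= part y)%N;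
  part_nonempty : forall i : 'I_n.+1, exists x, part x = i;
  cut_no_max : forall (i : 'I_n) (x : I), (part x <= i)%N ->
    exists y : I, (part y <= i)%N /\ (x < y)%O;
  cut_no_min : forall (i : 'I_n) (x : I), (i < part x)%N ->
    exists y : I, (i < part y)%N /\ (y < x)%O
}.

(* The linear order obtained from [I] by adding, for each [i] in [S], one new
   point at the i-th cut of [D]. *)
Definition insertion d (I : orderType d) n (D : dedekind I n)
  (S : {set 'I_n}) : Type := (I + {i : 'I_n | i \in S})%type.

Section InsertionOrder.
Context {d : Order.disp_t} {I : orderType d} {n : nat}.
Variables (D : dedekind I n) (S : {set 'I_n}).

Definition insertion_lt (u v : insertion D S) : bool :=
  match u, v with
  | inl x, inl y => (x < y)%O
  | inl x, inr j => (D x <= val j)%N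
  | inr i, inl y => (val i < D y)%N
  | inr i, inr j => (val i < val j)%N
  end.

Fact insertion_lt_irr : irreflexive insertion_lt.
Proof. by case=> [x|i] /=; rewrite ?ltxx ?ltnn. Qed.

Fact insertion_lt_trans : transitive insertion_lt.
Proof.
move=> [y|j] [x|i] [z|k] //=.
- exact: lt_trans.
- by move=> /ltW/(part_nondecreasing D); apply: leq_trans.
- by move=> iy /ltW/(part_nondecreasing D); apply: leq_trans.
- exact: leq_trans.
- move=> xj jz; have [//|zx|zx] := ltgtP x z.
    by have := leq_ltn_trans (part_nondecreasing D (ltW zx)) (leq_ltn_trans xj jz);
      rewrite ltnn.
  by rewrite zx in xj; have := leq_ltn_trans xj jz; rewrite ltnn.
- by move=> xj /ltnW; apply: leq_trans.
- exact: ltn_trans.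
- exact: ltn_trans.
Qed.

HB.instance Definition _ := Choice.on (insertion D S).
HB.instance Definition _ := Order.Lt_isPOrder.Build d (insertion D S)
  insertion_lt_irr insertion_lt_trans.

Fact insertion_le_total : total (<=%O : rel (insertion D S)).
Proof.
move=> u v; rewrite !le_eqVlt /Order.lt /=.
case: u v => [x|i] [y|j] /=.
- by case: (ltgtP x y) => [| |->]; rewrite ?eqxx ?orbT.
- by case: (leqP (D x) (val j)) => //; rewrite ?orbT.
- by case: (leqP (D y) (val i)) => //; rewrite ?orbT.
- by case: (ltngtP (val i) (val j)) => [| |/val_inj/val_inj ->];
    rewrite ?eqxx ?orbT.
Qed.

HB.instance Definition _ :=
  Order.POrder_isTotal.Build d (insertion D S) insertion_le_total.

End InsertionOrder.

(** * EM-types and distality *)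

Section Distality.
Context {L : language} {T : theory L}.
Variable U : monster T.

(* Tuples are functions from an index type [X], the size of the tuple. *)

Definition increasing n d (I : orderType d) (s : 'I_n -> I) : Prop :=
  forall i j : 'I_n, (i < j)%N -> (s i < s j)%O.

(* In a formula over ['I_n * X], the variable [(k, x)] is the coordinate [x] of
   the tuple of variables x_k. *)
Definition sat_at n X d (I : orderType d) (b : I -> X -> U) (s : 'I_n -> I)
    (phi : formula L ('I_n * X)) : Prop :=
  sat (fun kx : 'I_n * X => b (s kx.1) kx.2) phi.

(* A set of formulas phi(x_0, ..., x_{n-1}), for varying n. *)
Definition EM_set (X : Type) := forall n : nat, set (formula L ('I_n * X)).

Definition EM_type X d (I : orderType d) (b : I -> X -> U) : EM_set X :=
  fun n phi => forall s : 'I_n -> I, increasing s -> sat_at b s phi.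

Definition indiscernible X d (I : orderType d) (b : I -> X -> U) : Prop :=
  forall n (phi : formula L ('I_n * X)) (s t : 'I_n -> I),
    increasing s -> increasing t -> (sat_at b s phi <-> sat_at b t phi).

Lemma indiscernible_EM_complete X d (I : orderType d) (b : I -> X -> U) :
  indiscernible b <->
  forall n (phi : formula L ('I_n * X)),
    EM_type b phi \/ EM_type b (fneg phi).
Proof.
split=> [bI n phi|bC n phi s t ss tt].
  have [bphi|] := pselect (EM_type b phi); first by left.
  move=> /existsNP[s /not_implyP[ss nphi]]; right=> t tt phit.
  exact/nphi/(bI _ phi t s).
have [bphi|bphi] := bC n phi.
  by split=> _; apply: bphi.
by split=> [/(bphi s ss)|/(bphi t tt)].
Qed.

Definition complete_EM_type X (Gamma : EM_set X) : Prop :=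
  exists (d : Order.disp_t) (I : orderType d) (b : I -> X -> U),
    [/\ small U I, infinite_set [set: I], indiscernible b
      & EM_type b = Gamma].

Definition insert X d (I : orderType d) n (D : dedekind I n) (b : I -> X -> U)
    (A : 'I_n -> X -> U) (S : {set 'I_n}) (u : insertion D S) : X -> U :=
  match u with
  | inl x => b x
  | inr i => A (val i)
  end.

(* The subsequence (a_i : i in S) of [A] inserts into the partition [D]. *)
Definition inserts X d (I : orderType d) n (D : dedekind I n) (b : I -> X -> U)
    (A : 'I_n -> X -> U) (S : {set 'I_n}) : Prop :=
  indiscernible (@insert X d I n D b A S).

Definition distal_partition m X d (I : orderType d) n (D : dedekind I n)
    (b : I -> X -> U) : Prop :=
  forall A : 'I_n -> X -> U, ~ inserts D b A [set: 'I_n]%SET ->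
    exists S : {set 'I_n}, #|S| = m /\ ~ inserts D b A S.

Definition distal_EM_type m X (Gamma : EM_set X) : Prop :=
  forall (d : Order.disp_t) (I : orderType d) (b : I -> X -> U)
         (D : dedekind I m.+1),
    small U I -> indiscernible b -> EM_type b = Gamma ->
    distal_partition m D b.

Definition distal_theory m : Prop :=
  forall (X : Type) (Gamma : EM_set X),
    small U X -> complete_EM_type Gamma -> distal_EM_type m Gamma.

(* [None] stands for omega. *)
Definition DR : option nat :=
  match pselect (exists m, (0 < m)%N && `[< distal_theory m >]) with
  | left h => Some (ex_minn h)
  | right _ => None
  end.

End Distality.

Definition rank_ge (r : option nat) (k : nat) : Prop :=
  match r with
  | Some m => (k <= m)%N
  | None => True
  end.

(* Main.v *)
(* It suffices to refute 1-distality. Let (b_q : q in Q) be a nonconstant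
   indiscernible sequence of elements. By stability it is totally indiscernible.
   Split a subsequence b' into three blocks and put the same remaining element a
   at both cuts: either copy alone inserts, because b' together with a is an
   injective family of members of a totally indiscernible sequence, but both
   copies do not, because a = a while the members of b' are distinct.

   To find (b_q) in the monster model, take an injective sequence in an infinite
   model M and the tensor powers of a nonprincipal ultrafilter on nat; they
   generate a filter on the maps e : Q -> nat. The model is the Skolem hull of
   the generic map inside the ultrapower of M along an ultrafilter V containing
   this filter. It is built directly as a quotient modulo V of Skolem codes,
   whose number is at most that of the formulas, so that it embeds into the
   monster model. *)
From HB Require Import structures.
From mathcomp Require Import all_boot all_order all_fingroup all_algebra.
From mathcomp Require Import boolp classical_sets functions cardinality filter.
From mathcomp Require Import lra.
Require Import Defs.

Set Implicit Arguments.
Unset Strict Implicit.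
Unset Printing Implicit Defensive.

Import Order.TTheory GRing.Theory Num.Theory.
Local Open Scope classical_set_scope.

(** * Renaming variables *)

Fixpoint trename L V W (r : V -> W) (t : term L V) : term L W :=
  match t with
  | tvar v => tvar (r v)
  | tapp f args => tapp f (fun i => trename r (args i))
  end.

Fixpoint frename L V W (r : V -> W) (phi : formula L V) : formula L W :=
  match phi with
  | fbot => fbot
  | feq t u => feq (trename r t) (trename r u)
  | frel R args => frel R (fun i => trename r (args i))
  | fimp p q => fimp (frename r p) (frename r q)
  | fall p => fall (frename (omap r) p)
  end.

Lemma eval_rename L (M : structure L) V W (r : V -> W) (e : W -> M)
    (t : term L V) :
  eval e (trename r t) = eval (e \o r) t.
Proof. by elim: t => //= f args IH; congr finterp; apply/funext. Qed.

Lemma extend_omap (M : Type) V W (r : V -> W) (e : W -> M) (x : M) :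
  (fun v => oapp e x (omap r v)) = (fun v => oapp (e \o r) x v).
Proof. by apply/funext => -[]. Qed.

Lemma sat_rename L (M : structure L) V W (r : V -> W) (e : W -> M)
    (phi : formula L V) :
  sat e (frename r phi) <-> sat (e \o r) phi.
Proof.
elim: phi W r e => [|? t u|? R args|? p IHp q IHq|? p IHp] //= W r e.
- by rewrite !eval_rename.
- suff -> : (fun i => eval e (trename r (args i))) =
            (fun i => eval (e \o r) (args i)) by [].
  by apply/funext => i; rewrite eval_rename.
- by rewrite IHp IHq.
- by split=> H x; have := H x; rewrite IHp /comp /extend extend_omap.
Qed.

(** * Skolem hulls in ultrapowers *)

Section Ultrafilter.
Context {E : Type} {V : set_system E} {UV : UltraFilter V}.

Lemma ultraN (A : set E) : V (~` A) <-> ~ V A.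
Proof.
split=> [VnA VA|nVA]; last by have [] := in_ultra_setVsetC A UV.
by have [x []] := filter_ex (filterI VA VnA).
Qed.

Lemma ultra_imply (A B : set E) : V [set e | A e -> B e] <-> (V A -> V B).
Proof.
split=> [VAB VA|VAB]; first by apply: filterS2 VAB VA => e; apply.
have [/VAB VB|/ultraN VnA] := pselect (V A).
  by apply: filterS VB => e Be _.
by apply: filterS VnA => e nAe /nAe.
Qed.

End Ultrafilter.

(** The class of [p] is the predicate [R p] itself, so extensionality turns equivalence into
    equality; [sec] chooses representatives. *)
Lemma exists_quotient (C : Type) (R : C -> C -> Prop) :
  (forall p, R p p) -> (forall p q, R p q -> R q p) ->
  (forall p q r, R p q -> R q r -> R p r) ->
  exists (Q : Type) (pi : C -> Q) (sec : Q -> C),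
    cancel sec pi /\ (forall p q, pi p = pi q <-> R p q).
Proof.
move=> Rxx Rsym Rtrans.
have Req p q : R p q <-> R p = R q.
  split=> [pq|->]; last exact: Rxx.
  apply/funext => r; apply/propext; split; first exact/Rtrans/Rsym.
  exact: Rtrans.
pose Q := {A : set C | exists p, A = R p}.
pose pi p : Q := exist _ (R p) (ex_intro _ p erefl).
pose sec (y : Q) := projT1 (cid (projT2 y)).
exists Q, pi, sec; split=> [[A hA]|p q].
  rewrite /pi /sec /=; case: cid => p /= Ap; apply: eq_exist.
  by rewrite -Ap.
split=> [[/Req//]|/Req pq]; exact: eq_exist.
Qed.

Definition witness (M : Type) (x0 : M) (P : M -> Prop) : M :=
  match pselect (exists x, P x) with
  | left h => projT1 (cid h)
  | right _ => x0
  end.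

Lemma witnessP (M : Type) (x0 : M) (P : M -> Prop) :
  (exists x, P x) -> P (witness x0 P).
Proof. by rewrite /witness; case: pselect => // h _; case: cid. Qed.

(* Names for the elements of the Skolem hull of [G]; a code denotes a whole
   environment (a sequence of elements), whose entry 0 is the named element. *)
Inductive code (L : language) (G : Type) : Type :=
| gen of G
| wit of formula L (option nat) & code L G
| push of code L G & code L G.

Section Hull.
Context {L : language} {M : structure L} {G : Type}.
Local Notation code := (code L G).

Fixpoint denote (e : G -> M) (c : code) : nat -> M :=
  match c with
  | gen x => fun=> e x
  | wit phi d => fun=>
      witness (denote e d 0) (fun x => sat (extend (denote e d) x) phi)
  | push c d => fun n => if n is n'.+1 then denote e d n' else denote e c 0
  end.

(** Any environment of codes indexed by [X] merges into one code, read at positions [r] fixed in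
    advance. This is wanted because [wit] takes all its parameters from a single code. *)
Definition packable (X : Type) : Prop :=
  exists r : X -> nat, forall g : X -> code, exists c : code,
    forall e, denote e c \o r = fun x => denote e (g x) 0.

Lemma packable_option X : packable X -> packable (option X).
Proof.
move=> [r rP]; exists (oapp (S \o r) 0) => g.
have [c cP] := rP (g \o some); exists (push (g None) c) => e.
by apply/funext => -[x|] //=; have /(congr1 (@^~ x)) := cP e.
Qed.

Lemma packable_ord n : G -> packable 'I_n.
Proof.
move=> x0; exists val => g.
exists (foldr (@push L G) (gen L x0) [seq g i | i <- enum 'I_n]) => e.
apply/funext => i; rewrite /=.
have nthg (s : seq code) j : (j < size s)%N ->
    denote e (foldr (@push L G) (gen L x0) s) j =
    denote e (nth (gen L x0) s j) 0.
  by elim: s j => [|c s IHs] [|j] //= /IHs.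
rewrite nthg; last by rewrite size_map size_enum_ord.
by rewrite (nth_map i) ?size_enum_ord// nth_ord_enum.
Qed.

Lemma packable_void : G -> packable void.
Proof.
move=> x0; exists (of_void nat) => g; exists (gen L x0) => e.
by apply/funext => -[].
Qed.

End Hull.

Section Los.
Context {L : language} {M : structure L} {G E : Type}.
Context {V : set_system E} {UV : UltraFilter V}.
Variables (x0 : G) (v : E -> G -> M).
Local Notation code := (code L G).

(** The structure consists of codes modulo agreement on a [V]-large set. The induction of Los's
    theorem passes quantifiers because codes are closed under Skolem witnesses. Choosing
    representatives gives [enc], which bounds the size of [N]. *)
Lemma ultra_hull :
  exists (N : structure L) (c : G -> N) (enc : N -> code),
    [/\ injective enc,
        forall n (phi : formula L 'I_n) (s : 'I_n -> G),
          sat (c \o s) phi <-> V [set e | sat (v e \o s) phi]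
      & forall T, models M T -> models N T].
Proof.
pose val (e : E) (c : code) := denote (v e) c 0.
pose R (p q : code) := V [set e | val e p = val e q].
have [||p q r pq qr|Q [pi [sec [secK piR]]]] := @exists_quotient code R.
- by move=> p; apply: filterS filterT.
- by move=> p q; apply: filterS.
- by apply: filterS2 pq qr => e /= ->.
have sec_pi c : V [set e | val e (sec (pi c)) = val e c].
  by apply/piR; rewrite secK.
have fcode (f : fsym L) (g : 'I_(fsym_arity f) -> code) :
    exists c, forall e, val e c = finterp (fun i => val e (g i)).
  have [r rP] := @packable_ord L M G (fsym_arity f) x0.
  have [c cP] := rP g.
  (* The only witness of the equation [y = f(...)] is the value of [f]. *)
  exists (wit (feq (tvar None) (tapp f (fun i => tvar (Some (r i))))) c) => e.
  rewrite {1}/val /=.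
  set P := fun x => _; have : P (witness (denote (v e) c 0) P).
    by apply: witnessP; exists (finterp (fun i => denote (v e) c (r i))).
  rewrite {1}/P /= => ->; congr finterp; apply/funext => i.
  by have /(congr1 (@^~ i)) := cP (v e).
pose fint (f : fsym L) (args : 'I_(fsym_arity f) -> Q) :=
  pi (projT1 (cid (fcode f (sec \o args)))).
pose rint (r : rsym L) (args : 'I_(rsym_arity r) -> Q) :=
  V [set e | rinterp (fun i => val e (sec (args i)))].
pose N := Structure (inhabits (pi (gen L x0))) fint rint.
have evalN X (g : X -> code) (t : term L X) :
    V [set e | val e (sec (eval (pi \o g : X -> N) t)) =
               eval (fun x => val e (g x)) t].
  elim: t => [x|f args IH] /=; first exact: sec_pi.
  rewrite /fint; case: cid => c /= cP.
  apply: filterS2 (sec_pi c) (filter_forall _ IH) => e /= -> IHe.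
  by rewrite cP; congr finterp; apply/funext.
have los X (phi : formula L X) : @packable L M G X -> forall g : X -> code,
    sat (pi \o g : X -> N) phi <-> V [set e | sat (fun x => val e (g x)) phi].
  elim: phi => {X} [X|X t u|X r args|X p IHp q IHq|X p IHp] Xp g /=.
  - by split=> // /filter_ex[].
  - split=> [tu|Vtu].
      apply: filterS2 (evalN X g t) (evalN X g u) => e /= <- <-.
      by rewrite tu.
    rewrite -[LHS]secK -[RHS]secK; apply/piR; rewrite /R.
    apply: filterS3 Vtu (evalN X g t) (evalN X g u) => e /= tu.
    by rewrite tu => -> ->.
  - rewrite /rint; have H : V [set e | forall i,
        val e (sec (eval (pi \o g : X -> N) (args i))) =
        eval (fun x => val e (g x)) (args i)].
      by apply: filter_forall => i; apply: evalN.
    split=> V1; apply: filterS2 V1 H => e /= + He.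
      by under eq_fun do rewrite He.
    by under [X in _ -> rinterp X]eq_fun do rewrite He.
  - by rewrite (IHp Xp) (IHq Xp) -ultra_imply.
  - have ext c : extend (pi \o g : X -> N) (pi c) = pi \o (oapp g c).
      by apply/funext => -[].
    have extv e c : (fun x => val e (oapp g c x)) =
        extend (fun x => val e (g x)) (val e c).
      by apply/funext => -[].
    have Xo := packable_option Xp.
    split=> [H|H y]; last first.
      rewrite -(secK y) ext (IHp Xo); apply: filterS H => e /= H.
      by rewrite extv; apply: H.
    have [r rP] := Xp; have [c cP] := rP g.
    (* [w] names a counterexample to [p] wherever one exists, so wherever [p] holds at [w] it holds
       at every [x]. *)
    pose w := wit (fneg (frename (omap r) p)) c.
    have := H (pi w); rewrite ext (IHp Xo); apply: filterS => e /=.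
    rewrite extv => pw x; apply: contrapT => npx.
    have envE y :
        sat (extend (denote (v e) c) y) (fneg (frename (omap r) p)) <->
        ~ sat (extend (fun x => val e (g x)) y) p.
      by rewrite /= sat_rename /comp /extend extend_omap (cP (v e)).
    have : sat (extend (denote (v e) c) (val e w)) (fneg (frename (omap r) p)).
      apply: (@witnessP M (denote (v e) c 0) (fun y =>
        sat (extend (denote (v e) c) y) (fneg (frename (omap r) p)))).
      by exists x; apply/envE.
    by move/envE.
exists N, (pi \o @gen L G), sec; split.
- exact: can_inj secK.
- move=> n phi s; exact: (los 'I_n phi (packable_ord n x0) (@gen L G \o s)).
- move=> T MT phi Tphi.
  have := los void phi (packable_void x0) (fun x => of_void _ x).
  have -> : (pi \o (fun x => of_void _ x) : void -> N) = of_void N.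
    by apply/funext => -[].
  rewrite /holds => ->; apply: filterS filterT => e _ /=.
  by have := MT _ Tphi; congr sat; apply/funext => -[].
Qed.

End Los.

(** * Indiscernible sequences from ultrafilters *)

Section IteratedUltrafilter.
Context {A : Type} {W : set_system A} {UW : UltraFilter W}.
Implicit Types P Q : seq A -> Prop.

(* Membership of [P] in the n-fold product of the ultrafilter [W]. *)
Fixpoint almost_all n P : Prop :=
  if n is n'.+1 then W [set i | almost_all n' (fun r => P (i :: r))]
  else P [::].

Lemma almost_allI n P Q :
  almost_all n P -> almost_all n Q -> almost_all n (fun r => P r /\ Q r).
Proof.
elim: n P Q => [|n IHn] P Q //=; apply: filterS2 => i; exact: IHn.
Qed.

Lemma almost_all_ex n P : almost_all n P -> exists2 r, size r = n & P r.
Proof.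
elim: n P => [|n IHn] P /=; first by exists [::].
by move=> /filter_ex[i /IHn[r <- Pr]]; exists (i :: r).
Qed.

Lemma almost_allVN n P : almost_all n P \/ almost_all n (fun r => ~ P r).
Proof.
elim: n P => [|n IHn] P /=; first exact: EM.
have [|WnP] :=
  in_ultra_setVsetC [set i | almost_all n (fun r => P (i :: r))] UW.
  by left.
by right; apply: filterS WnP => i /= nP; case: (IHn (fun r => P (i :: r))).
Qed.

(** The coordinates dropped by the mask are quantified vacuously. *)
Lemma almost_all_mask m P :
  almost_all (count id m) P -> almost_all (size m) (fun r => P (mask m r)).
Proof.
elim: m P => [|[] m IHm] P //=; first by apply: filterS => i; exact: IHm.
by move=> /IHm H; apply: filterS filterT.
Qed.

End IteratedUltrafilter.
Arguments almost_all {A} W n P.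

(** [F] is generated by the cylinders over finite increasing lists whose base is large for the
    product ultrafilter. Largeness of the base depends on the length of the list and not on its
    points, whence the invariance. *)
Lemma exists_indiscernible_ultrafilter d (K : orderType d) :
  exists V : set_system (K -> nat), [/\ UltraFilter V,
    forall n (P : ('I_n -> nat) -> Prop) (s t : 'I_n -> K),
      increasing s -> increasing t ->
      V [set e : K -> nat | P (e \o s)] -> V [set e : K -> nat | P (e \o t)]
  & forall x y : K, (x < y)%O -> V [set e : K -> nat | e x <> e y]].
Proof.
have [W [UW ooW]] := ultraFilterLemma eventually_filter.
pose F : set_system (K -> nat) := [set S | exists l P,
  [/\ sorted <%O%O l, almost_all W (size l) P &
      forall e : K -> nat, P (map e l) -> S e]].
(* A large condition on the values at [l] lifts to any larger list [l'], so two members of [F] can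
   be compared over a common list. *)
have Fmerge (l l' : seq K) P : sorted <%O%O l -> sorted <%O%O l' ->
    {subset l <= l'} -> almost_all W (size l) P ->
    exists2 Q, almost_all W (size l') Q &
      forall e : K -> nat, Q (map e l') -> P (map e l).
  move=> sl sl' ll'.
  have -> : l = mask (map (mem l) l') l'.
    rewrite -filter_mask; apply: lt_sorted_eq => //.
      by rewrite sorted_filter//; exact: lt_trans.
    by move=> x; rewrite mem_filter andb_idr// => /ll'.
  set m := map _ l'; have sm : size m = size l' by rewrite size_map.
  rewrite size_mask// => /almost_all_mask; rewrite sm => HQ.
  by eexists; first exact: HQ; move=> e /=; rewrite map_mask.
have FF : ProperFilter F.
  split.
    move=> [l [P [sl /almost_all_ex[r sr Pr] PF]]].
    (* The entries of [l] are distinct, so a map can take any prescribed values [r] on them. *)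
    apply: (PF (fun x => nth 0 r (index x l))).
    suff -> : [seq nth 0 r (index x l) | x <- l] = r by [].
    apply: (@eq_from_nth _ 0); rewrite size_map ?sr// => i il.
    case: l sl sr il {PF} => // x l sl sr il.
    by rewrite (nth_map x)// index_uniq// lt_sorted_uniq.
  split.
  - by exists [::], (fun=> True).
  - move=> S S' [l [P [sl lP PS]]] [l' [P' [sl' lP' PS']]].
    pose k := sort <=%O (undup (l ++ l')).
    have sk : sorted <%O%O k by rewrite sort_lt_sorted undup_uniq.
    have [|Q kQ QP] := Fmerge l k P sl sk _ lP.
      by move=> x xl; rewrite mem_sort mem_undup mem_cat xl.
    have [|Q' kQ' QP'] := Fmerge l' k P' sl' sk _ lP'.
      by move=> x xl; rewrite mem_sort mem_undup mem_cat xl orbT.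
    exists k, (fun r => Q r /\ Q' r); split=> //; first exact: almost_allI.
    by move=> e [/QP/PS ? /QP'/PS' ?].
  - move=> S S' SS' [l [P [sl lP PS]]]; exists l, P; split=> // e /PS.
    exact: SS'.
have [V [UV FV]] := ultraFilterLemma FF.
have Fin n (P : ('I_n -> nat) -> Prop) (s : 'I_n -> K) : increasing s ->
    almost_all W n (fun r => P (fun i => nth 0 r i)) ->
    V [set e : K -> nat | P (e \o s)].
  move=> ss nP; apply: FV; exists (map s (enum 'I_n)).
  exists (fun r => P (fun i => nth 0 r i)); split.
  - apply: (homo_sorted (e := fun i j : 'I_n => (i < j)%N)) => //.
    have := iota_ltn_sorted 0 n; rewrite -val_enum_ord sorted_map.
    exact: sub_sorted.
  - by rewrite size_map size_enum_ord.
  - move=> e /=; congr P; apply/funext => i.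
    rewrite -map_comp (nth_map i) ?size_enum_ord// nth_ord_enum//.
exists V; split=> //.
- move=> n P s t ss st VP.
  (* Either [P] or its negation is large for the product; the negation would put the complement of
     the set in [VP] into [V]. *)
  have [nP|nnP] := almost_allVN n (fun r => P (fun i => nth 0 r i)).
    exact: Fin nP.
  by have /ultraN := Fin n (fun f => ~ P f) s ss nnP.
- move=> x y xy.
  pose s (i : 'I_2) := if i == ord0 then x else y.
  apply: (Fin 2 (fun f => f ord0 <> f ord_max) s).
    by move=> [[|[|i]] //= ?] [[|[|j]] //= ?].
  (* For every first coordinate [i], all [j > i] differ from it, and [W] extends the filter of
     cofinite sets. *)
  apply: (filterS (F := W) (P := setT)) filterT => i _; apply: ooW.
  exists i.+1 => // j /=.
  by move=> ij ijE; rewrite -ijE ltnn in ij.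
Qed.

(** * Smallness and the passage to the monster model *)

Lemma smaller_than_inj (K X Y : Type) (f : X -> Y) :
  injective f -> smaller_than K [set: Y] -> smaller_than K [set: X].
Proof.
move=> finj Ysmall KX; apply: Ysmall; apply: card_le_trans KX _.
have := @card_ge_preimage X Y setT f; rewrite preimage_setT; apply.
by move=> x y _ _; apply: finj.
Qed.

Section CodeEncoding.
Context {L : language} {G : countType}.

(** Bounds the number of codes by that of the formulas, against which [kappa_large] is stated. [wit]
    and [push] both give implications, but only the premise coming from [wit] is a universal
    formula. *)
Fixpoint code_formula (c : code L G) : formula L nat :=
  match c with
  | gen x => feq (tvar (pickle x)) (tvar 0)
  | wit phi d => fimp (fall phi) (code_formula d)
  | push c d => fimp (code_formula c) (code_formula d)
  end.

Lemma code_formula_inj : injective code_formula.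
Proof.
have nfall (c : code L G) phi : code_formula c <> fall phi by case: c.
elim=> [x|phi c IHc|c IHc d IHd] [y|psi c'|c' d'] //=.
- by move=> [/(pcan_inj pickleK) ->].
- by move=> [-> /IHc ->].
- by move=> [/esym/nfall].
- by move=> [/nfall].
- by move=> [/IHc -> /IHd ->].
Qed.

End CodeEncoding.

Section Monster.
Context {L : language} {T : theory L}.
Variable U : monster T.

Lemma small_inj_formula X (f : X -> formula L nat) : injective f -> small U X.
Proof. by move=> finj; exact: smaller_than_inj finj (@kappa_large _ _ U). Qed.

Lemma small_countable (X : countType) : small U X.
Proof.
apply: (@small_inj_formula X (fun x => feq (tvar (pickle x)) (tvar 0))).
by move=> x y [/(pcan_inj pickleK)].
Qed.

Lemma exists_indiscernible : has_infinite_models T -> exists b : rat -> U,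
  injective b /\
  forall n (phi : formula L 'I_n) (s t : 'I_n -> rat),
    increasing s -> increasing t -> sat (b \o s) phi -> sat (b \o t) phi.
Proof.
move=> [M [MT /infiniteP Minf]].
have [a ainj] : exists a : nat -> M, injective a.
  have /card_leP[f] := Minf.
  exists (fun n => val (f (SigSub (mem_setT n)))) => m n /val_inj.
  by move=> /(@inj _ _ _ f); rewrite !inE => /(_ I I)[].
have [V [UV Vindisc Vneq]] := exists_indiscernible_ultrafilter rat.
have [N [c [enc [enc_inj cV NT]]]] :=
  ultra_hull (G := rat) (V := V) 0%R (fun e x => a (e x)).
have [h hel] : exists h : N -> U, elementary_embedding h.
  apply: monster_universal; first exact: NT MT.
  apply: (small_inj_formula (f := code_formula \o enc)).
  exact: inj_comp code_formula_inj enc_inj.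
have hcV n (phi : formula L 'I_n) s :
    sat (h \o c \o s) phi <-> V [set e : rat -> nat | sat (a \o (e \o s)) phi].
  by rewrite -[X in _ <-> X]cV hel.
exists (h \o c); split=> [x y|n phi s t ss st]; last first.
  by rewrite !hcV; apply: (Vindisc n (fun f => sat (a \o f) phi)).
suff lt_neq u v : (u < v)%O -> h (c u) <> h (c v).
  by move=> hxy; have [/lt_neq/(_ hxy)|/lt_neq/(_ (esym hxy))|] := ltgtP x y.
move=> uv huv.
pose s (i : 'I_2) := if i == ord0 then u else v.
have /(hcV _ (feq (tvar ord0) (tvar ord_max)) s) : sat (h \o c \o s)
  (feq (tvar ord0) (tvar ord_max)) by [].
move=> /= Vuv.
by have [e [/ainj + /(_ _)]] := filter_ex (filterI Vuv (Vneq u v uv)).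
Qed.

End Monster.

(** * Stability and total indiscernibility *)

Lemma sort_injective d (K : orderType d) n (s : 'I_n -> K) : injective s ->
  exists (s' : 'I_n -> K) (p : {perm 'I_n}), increasing s' /\ s = s' \o p.
Proof.
move=> sinj; case: n s sinj => [|n] s sinj.
  by exists s, 1%g; split=> [[]//|]; apply/funext => -[].
pose l := sort <=%O%O (codom s).
have sl : size l = n.+1 by rewrite size_sort size_codom card_ord.
have ltl : sorted <%O%O l.
  by rewrite sort_lt_sorted; apply/injectiveP.
have mem_l k : s k \in l by rewrite mem_sort codom_f.
have il k : (index (s k) l < n.+1)%N by rewrite -sl index_mem.
have pinj : injective (fun k => Ordinal (il k)).
  move=> i j [/(congr1 (nth (s ord0) l))]; rewrite !nth_index//; exact: sinj.
exists (fun i => nth (s ord0) l i), (perm pinj); split.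
- by move=> i j ij; rewrite lt_sorted_ltn_nth// inE sl.
- by apply/funext => k; rewrite /= permE /= nth_index.
Qed.

Section TotalIndiscernibility.
Context {L : language} {M : structure L}.
Variable b : rat -> M.
Hypothesis b_indisc : forall n (phi : formula L 'I_n) (s t : 'I_n -> rat),
  increasing s -> increasing t -> sat (b \o s) phi -> sat (b \o t) phi.
Hypothesis M_stable : forall p q (phi : formula L ('I_p + 'I_q)),
  ~ has_order_property M phi.

(* If the swap changed the truth value, then moving only the entries at i and j
   through [0, 1), with the others fixed outside, would order the points t m. *)
Lemma sat_swap_adjacent n (phi : formula L 'I_n) (s : 'I_n -> rat)
    (i j : 'I_n) :
  val j = i.+1 -> increasing s -> sat (b \o s) phi ->
  sat (b \o s \o tperm i j) phi.
Proof.
move=> ijE ss sphi; apply: contrapT => nsphi.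
pose t (m : nat) : rat := (1 - m.+1%:R^-1)%R.
have t01 m : (0 <= t m < 1)%R.
  rewrite subr_ge0 ltrBlDr ltrDl invr_gt0 ltr0n andbT.
  by rewrite invf_le1 ?ltr0n// ler1n.
have t_lt m m' : (m < m')%N -> (t m < t m')%R.
  by move=> mm'; rewrite /t ltrD2l ltrN2 ltf_pV2 ?posrE// ltr_nat.
(* Entries before [i] go to [k - n < 0] and entries after [j] to [k >= 1], which leaves [0, 1) free
   for [x] and [y]. *)
pose w (x y : rat) (k : 'I_n) : rat :=
  if k == i then x else if k == j then y else
  if (k < i)%N then (k%:R - n%:R)%R else k%:R%R.
have ij : i != j by rewrite -val_eqE ijE /= neq_ltn ltnSn.
have w_i x y : w x y i = x by rewrite /w eqxx.
have w_j x y : w x y j = y by rewrite /w eq_sym (negPf ij) eqxx.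
have w_lt x y (k : 'I_n) : (k < i)%N -> w x y k = (k%:R - n%:R)%R.
  by move=> ki; rewrite /w -!val_eqE ijE /= ki !ltn_eqF// ltnW.
have w_gt x y (k : 'I_n) : (j < k)%N -> w x y k = k%:R%R.
  rewrite ijE => jk; have ik := ltnW jk.
  by rewrite /w -!val_eqE ijE /= !gtn_eqF// ltnNge ltnW.
have wP (k : 'I_n) : [\/ (k < i)%N, k = i, k = j | (j < k)%N].
  have [ki|ik|/val_inj ->] := ltngtP k i; [exact: Or41| |exact: Or42].
  have [kj|jk|/val_inj ->] := ltngtP k j; [|exact: Or44|exact: Or43].
  by rewrite ijE ltnNge ik in kj.
have w_incr m m' : (m < m')%N -> increasing (w (t m) (t m')).
  move=> mm' k k' kk'; have [tm tm'] := (t01 m, t01 m').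
  have tmm' := t_lt _ _ mm'.
  have kk'R : (k%:R < k'%:R :> rat)%R by rewrite ltr_nat.
  have kn : (k%:R + 1 <= n%:R :> rat)%R by rewrite natr1 ler_nat.
  have k'1 : (1 <= k'%:R :> rat)%R by rewrite ler1n (leq_trans _ kk').
  have [k'i|k'E|k'E|jk'] := wP k'.
  - by rewrite !w_lt ?(ltn_trans kk')//; lra.
  - by rewrite k'E w_i w_lt -?k'E//; lra.
  - rewrite k'E w_j in kk' *; have [ki|->|kj|jk] := wP k.
    + by rewrite w_lt//; lra.
    + by rewrite w_i.
    + by rewrite kj ltnn in kk'.
    + by have := ltn_trans kk' jk; rewrite ltnn.
  - rewrite (w_gt _ _ k')//; have [ki|->|->|jk] := wP k.
    + by rewrite w_lt//; lra.
    + by rewrite w_i; lra.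
    + by rewrite w_j; lra.
    + by rewrite w_gt.
have w_swap x y : w y x = w x y \o tperm i j.
  apply/funext => k; rewrite /w /=; case: tpermP => [->|->|/eqP ki /eqP kj].
  - by rewrite eqxx eq_sym (negPf ij) eqxx.
  - by rewrite eqxx eq_sym (negPf ij) eqxx.
  - by rewrite (negPf ki) (negPf kj).
(* Only the variable at [j] moves to the second tuple, so the two moving entries are controlled
   separately. *)
pose psi := frename (fun k => if k == j then inr k else inl k) phi.
apply: (M_stable (phi := psi)).
(* Odd against even indices keep the two entries distinct: [2m + 1 < 2m'] exactly when [m < m']. The
   [0] fills a coordinate that [psi] does not read. *)
exists (fun m => b \o w (t m.*2.+1) 0%R).
exists (fun m => b \o w 0%R (t m.*2)) => m m'.
rewrite sat_rename.
have -> : (fun v => match v with inl k => (b \o w (t m.*2.+1) 0%R) k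
    | inr k => (b \o w 0%R (t m'.*2)) k end)
    \o (fun k => if k == j then inr k else inl k) =
    b \o w (t m.*2.+1) (t m'.*2).
  apply/funext => k /=; have [->|kj] /= := eqVneq k j; first by rewrite !w_j.
  by rewrite /w (negPf kj).
have [mm'|m'm] := ltnP m m'; split=> //.
- move=> _; apply: b_indisc sphi => //; apply: w_incr.
  by rewrite -doubleS leq_double.
(* Here the entries at [i] and [j] are in decreasing order; undoing the swap gives an increasing
   tuple, and indiscernibility transfers the swapped [phi] to [s], against [nsphi]. *)
- rewrite w_swap compA -sat_rename => sw; case: nsphi; rewrite -sat_rename.
  apply: b_indisc sw => //; apply: w_incr.
  by rewrite ltnS leq_double.
Qed.

(** Adjacent transpositions generate the symmetric group. *)
Lemma sat_perm n (phi : formula L 'I_n) (s : 'I_n -> rat) (p : {perm 'I_n}) :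
  increasing s -> sat (b \o s) phi -> sat (b \o s \o p) phi.
Proof.
(* Quantifying over all formulas lets one factor of a product be absorbed into the formula by
   renaming. *)
pose good (p : {perm 'I_n}) := forall phi s,
  increasing s -> sat (b \o s) phi -> sat (b \o s \o p) phi.
suff : good p by apply.
have good1 : good 1%g.
  by move=> f u uu; congr sat; apply/funext => k; rewrite /= perm1.
have goodM p1 p2 : good p1 -> good p2 -> good (p1 * p2)%g.
  move=> g1 g2 f u uu fu.
  have -> : b \o u \o (p1 * p2)%g = b \o u \o p2 \o p1.
    by apply/funext => k; rewrite /= permM.
  by rewrite -sat_rename; apply: g2 => //; rewrite sat_rename; apply: g1.
have good_tperm_lt k (i j : 'I_n) : val j = (i + k.+1)%N -> good (tperm i j).
  elim: k j => [|k IHk] j ijE.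
    by move=> f u uu; apply: sat_swap_adjacent => //; rewrite ijE addn1.
  have lt_j' : (i + k.+1 < n)%N.
    by apply: leq_trans (ltn_ord j); rewrite ijE ltnS leq_add2l.
  pose j' := Ordinal lt_j'.
  have gj : good (tperm j' j).
    by move=> f u uu; apply: sat_swap_adjacent => //; rewrite ijE addnS.
  (* Conjugating by the adjacent transposition of [j'] and [j] reduces the distance from [i] by
     one. *)
  have -> : tperm i j = (tperm i j' ^ tperm j' j)%g.
    rewrite tpermJ tpermL tpermD//.
      by rewrite -val_eqE /= -[X in _ == X]addn0 eqn_add2l.
    by rewrite -val_eqE /= ijE -[X in _ == X]addn0 eqn_add2l.
  rewrite conjgE tpermV; apply: (goodM _ _ gj); apply: goodM gj.
  exact: (IHk j').
have good_tperm (i j : 'I_n) : good (tperm i j).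
  have [ij|ji|/val_inj ->] := ltngtP (val i) (val j); last by rewrite tperm1.
  - by apply: (good_tperm_lt (j - i.+1)%N); rewrite addnS -addSn subnKC.
  - rewrite tpermC; apply: (good_tperm_lt (i - j.+1)%N).
    by rewrite addnS -addSn subnKC.
have [ts -> _] := prod_tpermP p.
by elim: ts => [|t ts IHts]; rewrite ?big_nil// big_cons; apply: goodM.
Qed.

Lemma sat_injective n (phi : formula L 'I_n) (s t : 'I_n -> rat) :
  injective s -> injective t -> sat (b \o s) phi -> sat (b \o t) phi.
Proof.
move=> /sort_injective[s' [p [s's ->]]] /sort_injective[t' [q [t't ->]]].
rewrite compA -sat_rename => /(sat_perm p^-1%g s's); rewrite sat_rename.
have -> : b \o s' \o p^-1%g \o p = b \o s'.
  by apply/funext => k; rewrite /= permK.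
by move=> /(b_indisc s's t't)/(sat_perm q t't).
Qed.

End TotalIndiscernibility.

(** * Failure of 1-distality *)

(** Each block is a copy of the rationals, which has no endpoints, so no side of a cut has an
    extremum there. *)
Lemma lexi_dedekind n : inhabited (dedekind ('I_n.+1 *l rat)%type n).
Proof.
pose K : orderType _ := ('I_n.+1 *l rat)%type.
have le1 (x y : K) : (x <= y)%O -> (x.1 <= y.1)%N.
  by rewrite leEprodlexi => /andP[].
have ltD (i : 'I_n.+1) (q r : rat) : (q < r)%R -> ((i, q) < (i, r) :> K)%O.
  by move=> qr; rewrite ltEprodlexi /= lexx.
unshelve refine (inhabits (@Dedekind _ K n fst _ _ _ _)) => //.
- by move=> i; exists (i, 0%R).
- move=> i [k q] /= ki; exists (k, (q + 1)%R); split=> //.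
  by apply: ltD; rewrite ltrDl.
- move=> i [k q] /= ki; exists (k, (q - 1)%R); split=> //.
  by apply: ltD; rewrite ltrBlDr ltrDl.
Qed.

Lemma increasing_injective n d (K : orderType d) (s : 'I_n -> K) :
  increasing s -> injective s.
Proof.
move=> ss i j sij; apply/val_inj; case: (ltngtP (val i) (val j)) => // /ss.
  by rewrite sij ltxx.
by rewrite sij ltxx.
Qed.

Section TotallyIndiscernible.
Context {L : language} {T : theory L} {U : monster T} {X : Type}.
Variable b : X -> U.
Hypothesis b_total : forall n (phi : formula L 'I_n) (s t : 'I_n -> X),
  injective s -> injective t -> sat (b \o s) phi -> sat (b \o t) phi.

(** The order of [I] is irrelevant to a totally indiscernible family, so the lemma serves both for
    the original sequence and for the one with a point inserted. *)
Lemma indiscernible_inj d (I : orderType d) (f : I -> X) :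
  injective f -> indiscernible (fun i (_ : unit) => b (f i)).
Proof.
move=> finj n phi s t ss st.
have satE (u : 'I_n -> I) : sat_at (fun i _ => b (f i)) u phi <->
    sat (b \o (f \o u)) (frename fst phi) by rewrite sat_rename.
have inj u : increasing u -> injective (f \o u).
  by move=> uu; apply: inj_comp finj (increasing_injective uu).
rewrite !satE; split; apply: b_total; exact: inj.
Qed.

End TotallyIndiscernible.

Theorem proposition3p17 (L : language) (T : theory L)
  (T_complete : complete_theory T) (T_infinite : has_infinite_models T)
  (U : monster T) (T_stable : stable T) : rank_ge (DR U) 2.
Proof.
(* A least [m] equal to 0 is excluded by positivity and one above 1 is as wanted, so only
   1-distality has to be refuted. *)
rewrite /DR; case: pselect => // hex; case: ex_minnP => -[//|[|//]].
move=> /andP[_ /asboolP distal1] _; exfalso.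
have [b [b_inj b_indisc]] := exists_indiscernible U T_infinite.
have b_total := sat_injective b_indisc
  (fun p q phi => T_stable U p q phi (@monster_models _ _ U)).
pose K : orderType _ := ('I_3 *l rat)%type.
have [D] := lexi_dedekind 2.
(* The successor keeps 0 out of the range of [f], so [b 0] is left over as the point to insert. *)
pose f (x : K) : rat := ((pickle (x : 'I_3 * rat)).+1%:R)%R.
have f_inj : injective f.
  by move=> x y /eqP; rewrite eqr_nat eqSS => /eqP/(pcan_inj pickleK).
have f_neq0 x : f x != 0%R by rewrite pnatr_eq0.
pose c x (_ : unit) := b (f x).
have c_indisc : indiscernible c by exact: indiscernible_inj b_total _ _ _ f_inj.
have K_small : small U K by exact: (@small_countable _ _ U ('I_3 * rat)%type).
pose y (k : nat) : K := (ord0, (k%:R)%R).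
have y_inj : injective y by move=> k l [/eqP]; rewrite eqr_nat => /eqP.
have [] := distal1 unit (EM_type c) (@small_countable _ _ U unit) _ _ K c D
  K_small c_indisc erefl
  (fun _ _ => b 0%R).
- exists _, K, c; split=> //; apply/infiniteP.
  have := @card_ge_preimage nat K setT y; rewrite preimage_setT; apply.
  by move=> m n _ _; apply: y_inj.
(* The equation between two variables holds at the two inserted copies [u] and fails at two points
   [t] of the sequence. *)
- pose u (i : 'I_2) : insertion D [set: 'I_2]%SET :=
    inr (exist _ i (finset.in_setT i)).
  pose t (i : 'I_2) : insertion D [set: 'I_2]%SET := inl (y i).
  have u_incr : increasing u by move=> i j ij; rewrite /Order.lt.
  have t_incr : increasing t.
    move=> i j ij; suff : (y i < y j)%O by [].
    by rewrite ltEprodlexi /= ltr_nat.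
  move=> ins; have [eq01 _] := ins 2
    (feq (tvar (ord0, tt)) (tvar (ord_max, tt))) u t u_incr t_incr.
  by have /b_inj/f_inj/y_inj := eq01 erefl.
move=> S [S1 []].
(* With [S] a singleton, the value 0 is taken only once, so [g] is injective. *)
pose g (v : insertion D S) : rat := if v is inl x then f x else 0%R.
have g_inj : injective g.
  move=> [x|[i iS]] [z|[j jS]] //= => [/f_inj -> //|/eqP|/eqP|_].
  - by rewrite (negPf (f_neq0 x)).
  - by rewrite eq_sym (negPf (f_neq0 z)).
  - congr inr; apply: val_inj => /=; move/eqP/cards1P: S1 => [k SE].
    by move: iS jS; rewrite SE !inE => /eqP -> /eqP ->.
have -> : inserts D c (fun _ _ => b 0%R) S =
    indiscernible (U := U) (fun v (_ : unit) => b (g v)).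
  by congr indiscernible; apply/funext => -[x|i].
exact: indiscernible_inj b_total _ _ _ g_inj.
Qed.
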